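(* Let $v \ge 1$ and $n \ge 3$ be integers, let $r > 0$ and $\varepsilon > 0$, and let $x_1, \dots, x_n \in \mathbb{R}^v$ satisfy $\Lambda(x_1,\dots,x_n) \le \varepsilon$. Let the link function be $\phi(d) = \mathbb{I}\{d \le r\}$, so that the adjacency matrix $W$ is deterministic, with $W_{ij} = \mathbb{I}\{\|x_i - x_j\| \le r\}$ for $i \ne j$ and $W_{ii} = 0$. Let $d_{ij} = \|x_i - x_j\|$, let $\delta_{ij}$ be the graph distance between nodes $i$ and $j$ in the graph with adjacency matrix $W$, and define $\hat d_{ij} = r\,\delta_{ij}$. If $\varepsilon \le r/4$, then $$0 \le \hat d_{ij} - d_{ij} \le 4(\varepsilon/r)\, d_{ij} + r, \quad \text{for all } i,j \in \{1,\dots,n\},$$ which in particular implies that $$\left[\frac{1}{\binom{n}{2}} \sum_{1 \le i < j \le n} (\hat d_{ij} - d_{ij})^2\right]^{1/2} \le 4(\varepsilon/r)\,\rho + r,$$ where $\rho = \max_{i,j} \|x_i - x_j\|$ is the diameter of $\{x_1,\dots,x_n\}$.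
   Context: $\|\cdot\|$ is the Euclidean norm on $\mathbb{R}^v$ and $\mathbb{I}\{\cdot\}$ is the indicator function. Density of the point set: $\Lambda(x_1,\dots,x_n) := \sup_{x \in \Omega} \min_{1 \le i \le n} \|x - x_i\|$, where $\Omega$ is the convex hull of $\{x_1,\dots,x_n\}$. Graph distance: $\delta_{ij}$ is the infimum of the integers $\ell \ge 0$ such that there exist $k_0, \dots, k_\ell \in \{1,\dots,n\}$ with $k_0 = i$, $k_\ell = j$, and $W_{k_{s-1}k_s} = 1$ for all $s \in \{1,\dots,\ell\}$; by convention $\inf \emptyset = \infty$. *)

(* Defs.v *)
From mathcomp Require Import all_boot all_order all_algebra.
From mathcomp Require Import all_classical all_reals all_analysis.

Set Implicit Arguments.
Unset Strict Implicit.
Unset Printing Implicit Defensive.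

Import Order.TTheory GRing.Theory Num.Theory.

Local Open Scope classical_set_scope.
Local Open Scope ring_scope.

Section graph_distance.
Context {R : realType} {v n : nat}.
Implicit Types (x : 'I_n -> 'rV[R]_v) (W : 'M[R]_n) (i j : 'I_n).

(* The library norm `|u| on row vectors is the sup norm, hence this one. *)
Definition eucl_norm (u : 'rV[R]_v) : R := Num.sqrt (\sum_(k < v) u 0 k ^+ 2).

Definition eucl_dist (u w : 'rV[R]_v) : R := eucl_norm (u - w).

Definition convex_hull (A : set 'rV[R]_v) : set 'rV[R]_v :=
  smallest [set C | convex_set C] A.

(* The supremum is taken in \bar R, where it is always a genuine supremum; the unit
   +oo of min is harmless as soon as 0 < n. *)
Definition density x : \bar R :=
  ereal_sup [set (\big[Order.min/+oo]_(i < n) (eucl_dist y (x i))%:E)%E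
            | y in convex_hull (range x)].

Definition link (r d : R) : R := (d <= r)%R%:R.

Definition adjacency (r : R) x : 'M[R]_n :=
  \matrix_(i, j) (if i == j then 0 else link r (eucl_dist (x i) (x j))).

(* Only the values k 0, ..., k l matter. *)
Definition walk W i j (l : nat) : Prop :=
  exists k : nat -> 'I_n,
    [/\ k 0%N = i, k l = j &
        forall s, (1 <= s <= l)%N -> W (k s.-1) (k s) = 1].

(* ereal_inf set0 = +oo: nodes in different components are at distance +oo. *)
Definition graph_dist W i j : \bar R :=
  ereal_inf [set (l%:R)%:E | l in walk W i j].

Definition dist_est (r : R) x i j : \bar R :=
  (r%:E * graph_dist (adjacency r x) i j)%E.

(* Distances are nonnegative, so the unit 0 of max is harmless. *)
Definition diameter x : R :=
  \big[Num.max/0]_(i < n) \big[Num.max/0]_(j < n) eucl_dist (x i) (x j).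

End graph_distance.

(* Main.v *)
Require Import Defs.
From mathcomp Require Import all_boot all_order all_algebra.
From mathcomp Require Import all_classical all_reals all_analysis.
From mathcomp Require Import ring lra.

Import Order.TTheory GRing.Theory Num.Theory.
Local Open Scope classical_set_scope.
Local Open Scope ring_scope.

(** Write d for the Euclidean distance between two of the points.

    An edge joins points at distance at most r, so by the triangle inequality
    a walk with l edges has d <= r * l ([walk_dist_le]); this gives the lower
    bound.

    For the upper bound, cut the segment between the two points into m equal
    steps of length at most h = r - 2 * eps. The segment lies in the convex
    hull, so every cut point is within eps of one of the given points, and
    the points chosen for consecutive cuts are within eps + h + eps = r of
    each other: either they are joined by an edge or they have the same index,
    and in the latter case the step is dropped ([walk_along_segment]). One can
    take m <= d / h + 1, so the estimated distance is at most
    r * d / h + r, and r / h <= 1 + 4 * (eps / r) as soon as eps <= r / 4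
    ([dist_est_le]).

    The root mean square bound follows because each of the C(n, 2) errors lies
    between 0 and the pointwise bound at d equal to the diameter
    ([rms_pairs_le]). *)

(** * Euclidean norm *)

(** With A, B the two sums of squares and C the mixed sum, the sum of the
    squares of B * a i - C * b i is B * (A * B - C ^+ 2); one can divide by B
    unless b vanishes. *)
Lemma cauchy_schwarz (R : realFieldType) (I : finType) (a b : I -> R) :
  (\sum_i a i * b i) ^+ 2 <= (\sum_i a i ^+ 2) * (\sum_i b i ^+ 2).
Proof.
set A := \sum_i a i ^+ 2; set B := \sum_i b i ^+ 2; set C := \sum_i a i * b i.
have sumsq (c : I -> R) : 0 <= \sum_i c i ^+ 2.
  by apply: sumr_ge0 => i _; exact: sqr_ge0.
have : 0 <= B * (A * B - C ^+ 2).
  have -> : B * (A * B - C ^+ 2) = \sum_i (B * a i - C * b i) ^+ 2.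
    under eq_bigr do rewrite sqrrB !exprMn.
    rewrite big_split sumrB /= sumrMnl -!mulr_sumr -/A -/B.
    have -> : \sum_i B * a i * (C * b i) = B * C * C.
      by rewrite /C mulr_sumr; apply: eq_bigr => i _; rewrite -/C; ring.
    ring.
  exact: sumsq.
have [B0|Bn0] := eqVneq B 0; last first.
  have Bp : 0 < B by rewrite lt_neqAle eq_sym Bn0 sumsq.
  by rewrite pmulr_rge0// subr_ge0.
have C0 : C = 0.
  apply: big1 => i _; suff -> : b i = 0 by rewrite mulr0.
  apply/eqP; rewrite -sqrf_eq0; apply/eqP.
  by apply: (psumr_eq0P _ B0) => // k _; exact: sqr_ge0.
by rewrite C0 B0 mulr0 expr0n.
Qed.

Section euclidean_distance.
Context {R : realType} {v : nat}.
Implicit Types a b c : 'rV[R]_v.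

Lemma eucl_norm_ge0 a : 0 <= eucl_norm a.
Proof. exact: sqrtr_ge0. Qed.

Lemma eucl_normZ (t : R) a : eucl_norm (t *: a) = `|t| * eucl_norm a.
Proof.
rewrite /eucl_norm -sqrtr_sqr -sqrtrM ?sqr_ge0//; congr Num.sqrt.
by rewrite mulr_sumr; apply: eq_bigr => k _; rewrite mxE exprMn.
Qed.

Lemma eucl_normD a b : eucl_norm (a + b) <= eucl_norm a + eucl_norm b.
Proof.
have sq c : 0 <= \sum_k c 0 k ^+ 2 by apply: sumr_ge0 => k _; exact: sqr_ge0.
rewrite -[leRHS]ger0_norm ?addr_ge0 ?eucl_norm_ge0// -sqrtr_sqr ler_wsqrtr//.
rewrite sqrrD !sqr_sqrtr// -sqrtrM//.
under eq_bigr do rewrite mxE sqrrD.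
rewrite !big_split /= lerD2r lerD2l -mulr2n lerMn2r /=.
apply: le_trans (ler_norm _) _.
by rewrite -sqrtr_sqr ler_wsqrtr// cauchy_schwarz.
Qed.

Lemma eucl_dist_ge0 a b : 0 <= eucl_dist a b.
Proof. exact: eucl_norm_ge0. Qed.

Lemma eucl_dist0 a : eucl_dist a a = 0.
Proof. by rewrite /eucl_dist subrr -(scale0r a) eucl_normZ normr0 mul0r. Qed.

Lemma eucl_distC a b : eucl_dist a b = eucl_dist b a.
Proof.
by rewrite /eucl_dist -opprB -scaleN1r eucl_normZ normrN1 mul1r.
Qed.

Lemma eucl_dist_triangle b a c :
  eucl_dist a c <= eucl_dist a b + eucl_dist b c.
Proof.
by rewrite /eucl_dist -[a - c](subrKA b); exact: eucl_normD.
Qed.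

Definition segment_point a b (t : R) := (1 - t) *: a + t *: b.

Lemma segment_point0 a b : segment_point a b 0 = a.
Proof. by rewrite /segment_point subr0 scale1r scale0r addr0. Qed.

Lemma segment_point1 a b : segment_point a b 1 = b.
Proof. by rewrite /segment_point subrr scale0r scale1r add0r. Qed.

Lemma segment_point_dist a b s t :
  eucl_dist (segment_point a b s) (segment_point a b t)
    = `|s - t| * eucl_dist a b.
Proof.
rewrite distrC /eucl_dist -eucl_normZ; congr eucl_norm.
by apply/rowP => k; rewrite !mxE; ring.
Qed.

(** The hull is the intersection of all convex sets containing A, and each of
    them contains the segment. *)
Lemma convex_hull_segment (A : set 'rV[R]_v) a b t :
  A a -> A b -> 0 <= t <= 1 -> convex_hull A (segment_point a b t).
Proof.
move=> Aa Ab /andP[t0 t1] C [Cconv AC].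
rewrite /segment_point addrC; apply/set_mem.
by apply: (Cconv b a (Itv01 t0 t1)); rewrite inE; exact: AC.
Qed.

End euclidean_distance.

(** * Walks and graph distances *)

Section walks.
Context {R : realType} {n : nat}.
Implicit Types (W : 'M[R]_n) (i j : 'I_n).

Lemma walk0 W i : walk W i i 0.
Proof. by exists (fun=> i); split => // -[]. Qed.

Lemma walk_rcons W i j j' l :
  walk W i j l -> W j j' = 1 -> walk W i j' l.+1.
Proof.
move=> [k [k0 kl kW]] Wj; exists (fun s => if (s <= l)%N then k s else j').
split; rewrite ?ltnn//= => -[//|s]; rewrite /= ltnS => sl.
rewrite sl; case: ltnP => [sl'|ls]; first by rewrite (kW s.+1).
have -> : s = l by apply/eqP; rewrite eqn_leq sl ls.
by rewrite kl.
Qed.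

(** Every step of a walk follows an edge, and a vertex need not be joined to
    itself, so a chain that may stand still yields a walk only once its idle
    steps are removed; hence a length at most m rather than m. *)
Lemma walk_of_chain W (k : nat -> 'I_n) m :
  (forall s, (s < m)%N -> k s = k s.+1 \/ W (k s) (k s.+1) = 1) ->
  exists2 l, (l <= m)%N & walk W (k 0%N) (k m) l.
Proof.
elim: m => [|m IH] kW; first by exists 0%N => //; exact: walk0.
have [|l lm kl] := IH; first by move=> s sm; apply: kW; exact: ltnW.
have [<-|W1] := kW m (ltnSn m); first by exists l => //; exact: ltnW.
by exists l.+1 => //; exact: walk_rcons kl W1.
Qed.

Lemma graph_dist_le W i j l :
  walk W i j l -> (graph_dist W i j <= (l%:R)%:E)%E.
Proof. by move=> wl; apply: ereal_inf_lbound; exists l. Qed.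

End walks.

Section geometric_graph.
Context {R : realType} {v n : nat}.
Variables (r : R) (x : 'I_n -> 'rV[R]_v).
Implicit Types i j : 'I_n.

Lemma adjacencyP i j :
  adjacency r x i j = 1 <-> i <> j /\ eucl_dist (x i) (x j) <= r.
Proof.
rewrite mxE; case: eqP => [->|ij].
  by split=> [/eqP|[]//]; rewrite eq_sym oner_eq0.
rewrite /link; case: (boolP (_ <= r)) => _; first by split.
by split=> [/eqP|[]//]; rewrite eq_sym oner_eq0.
Qed.

Lemma walk_dist_le i j l :
  walk (adjacency r x) i j l -> eucl_dist (x i) (x j) <= r * l%:R.
Proof.
move=> [k [<- <-]]; elim: l => [|l IH] kW; first by rewrite eucl_dist0 mulr0.
apply: le_trans (eucl_dist_triangle (x (k l)) _ _) _.
rewrite -natr1 mulrDr mulr1 lerD//.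
  by apply: IH => s /andP[s1 sl]; apply: kW; rewrite s1 ltnW.
by have /adjacencyP[] := kW l.+1 (ltnSn l).
Qed.

Lemma dist_est_ge i j :
  0 < r -> ((eucl_dist (x i) (x j))%:E <= dist_est r x i j)%E.
Proof.
move=> r0; rewrite /dist_est -lee_pdivrMl//.
apply/ereal_infP => _ [l wl <-].
by rewrite -EFinM lee_fin ler_pdivrMl//; exact: walk_dist_le.
Qed.

(** A minimum over finitely many points is attained: a density bound gives an
    actual point within eps, not just one within every larger radius. *)
Lemma density_near eps y :
  (density x <= eps%:E)%E -> convex_hull (range x) y ->
  exists i, eucl_dist y (x i) <= eps.
Proof.
move=> dx hy.
have : (\big[Order.min/+oo]_(i < n) (eucl_dist y (x i))%:E <= eps%:E)%E.
  by apply: le_trans dx; apply: ereal_sup_ubound; exists y.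
by move/bigmin_leP => [//|[i _]]; rewrite lee_fin; exists i.
Qed.

(** Replacing each cut point of the segment by a nearby data point costs eps at
    both ends of a step, so steps of length at most r - 2 * eps become
    steps of length at most r. *)
Lemma walk_along_segment eps i j m :
  (density x <= eps%:E)%E -> (0 < m)%N ->
  eucl_dist (x i) (x j) <= (r - 2 * eps) * m%:R ->
  exists2 l, (l <= m)%N & walk (adjacency r x) i j l.
Proof.
move=> dx m0 dm.
have mR : 0 < m%:R :> R by rewrite ltr0n.
pose p s := segment_point (x i) (x j) (s%:R / m%:R).
(* p s is the s-th of the cut points p 0 = x i, ..., p m = x j. *)
have near_p s : (s <= m)%N -> exists q, eucl_dist (p s) (x q) <= eps.
  move=> sm; apply: density_near dx _; apply: convex_hull_segment.
  - by exists i.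
  - by exists j.
  - by rewrite divr_ge0//= ler_pdivrMr// mul1r ler_nat.
have eps0 : 0 <= eps.
  by have [q] := near_p 0%N isT; apply: le_trans; exact: eucl_dist_ge0.
(* Several indices may lie near an end point: i and j are imposed there, so
   that the chain starts and ends as required. *)
have /choice[k kP] s : exists q, [/\ (s <= m)%N -> eucl_dist (p s) (x q) <= eps,
    s = 0%N -> q = i & s = m -> q = j].
  have [->|s0] := eqVneq s 0%N.
    exists i; split=> // [_|em]; last by rewrite -em in m0.
    by rewrite /p mul0r segment_point0 eucl_dist0.
  have [->|sm] := eqVneq s m.
    exists j; split=> // [_|em]; last by rewrite em in m0.
    by rewrite /p divff ?gt_eqF// segment_point1 eucl_dist0.
  have [sm'|ms] := leqP s m; last first.
    by exists i; split=> // e; move/eqP: sm; rewrite e.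
  have [q qP] := near_p s sm'.
  by exists q; split=> // e; [move/eqP: s0|move/eqP: sm].
have k0 : k 0%N = i by have [_ ->] := kP 0%N.
have km : k m = j by have [_ _ ->] := kP m.
rewrite -k0 -km; apply: walk_of_chain => s sm.
have [|ks] := eqVneq (k s) (k s.+1); [by left|right].
apply/adjacencyP; split; first exact/eqP.
have [/(_ (ltnW sm)) ps _ _] := kP s; have [/(_ sm) ps1 _ _] := kP s.+1.
have step : eucl_dist (p s) (p s.+1) <= r - 2 * eps.
  rewrite segment_point_dist -mulrBl -natr1 opprD addrA subrr sub0r mulN1r normrN.
  by rewrite ger0_norm ?invr_ge0 ?ler0n// ler_pdivrMl// mulrC.
have := eucl_dist_triangle (p s) (x (k s)) (x (k s.+1)).
have := eucl_dist_triangle (p s.+1) (p s) (x (k s.+1)).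
rewrite (eucl_distC (x (k s)) (p s)); lra.
Qed.

(** The number of steps is the least integer above d / h, with h = r - 2 * eps.
    Taking the truncation plus one keeps it positive when d = 0, which is needed
    when distinct indices carry the same point. *)
Lemma dist_est_le eps i j :
  0 < r -> 0 <= eps -> (density x <= eps%:E)%E -> eps <= r / 4 ->
  (dist_est r x i j <=
    (eucl_dist (x i) (x j) + (4 * (eps / r) * eucl_dist (x i) (x j) + r))%:E)%E.
Proof.
move=> r0 eps0 dx epsr; set d := eucl_dist _ _; set h := r - 2 * eps.
have d0 : 0 <= d by exact: eucl_dist_ge0.
have h0 : 0 < h by rewrite /h; lra.
pose q := Num.truncn (d / h).
have [|l lm wl] := @walk_along_segment eps i j q.+1 dx isT.
  by rewrite mulrC -ler_pdivrMr// ltW// truncnS_gt.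
apply: (@le_trans _ _ (r * l%:R)%:E).
  by rewrite /dist_est EFinM lee_pmul2l// graph_dist_le.
rewrite lee_fin; apply: (@le_trans _ _ (r * q.+1%:R)).
  by rewrite ler_pM2l// ler_nat.
rewrite -natr1 mulrDr mulr1 addrA lerD2r.
have qh : q%:R * h <= d by rewrite -ler_pdivlMr// truncn_le divr_ge0// ltW.
have -> : d + 4 * (eps / r) * d = (1 + 4 * (eps / r)) * d by ring.
have er0 : 0 <= eps / r by rewrite divr_ge0// ltW.
(* After division by h this is r / h <= 1 + 4 * (eps / r), and the difference
   of the two sides has the sign of r - 4 * eps. *)
have rh : r <= (1 + 4 * (eps / r)) * h.
  rewrite -subr_ge0.
  have -> : (1 + 4 * (eps / r)) * h - r = 2 * (eps / r) * (r - 4 * eps).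
    by rewrite /h; field; rewrite gt_eqF.
  by apply: mulr_ge0; lra.
apply: (@le_trans _ _ ((1 + 4 * (eps / r)) * h * q%:R)).
  by rewrite ler_wpM2r.
by rewrite -mulrA [h * _]mulrC ler_wpM2l// addr_ge0// mulr_ge0.
Qed.

Lemma le_diameter i j : eucl_dist (x i) (x j) <= diameter x.
Proof.
apply: (bigmax_sup i) => //.
exact: (@le_bigmax _ _ _ 0 (fun j => eucl_dist (x i) (x j)) j).
Qed.

End geometric_graph.

(** * Root mean square over pairs *)

Lemma card_ltn_pairs (n : nat) :
  (\sum_(i < n) \sum_(j < n | i < j) 1 = 'C(n, 2))%N.
Proof.
rewrite (exchange_big_dep xpredT)//= -bin2_sum big_mkord.
apply: eq_bigr => j _; rewrite (big_ord_narrow (ltnW (ltn_ord j))).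
by rewrite sum1_card card_ord.
Qed.

(** Termwise comparison of the squares: the mean of the constant K ^+ 2 over the
    C(n, 2) pairs is K ^+ 2, and squaring preserves e i j <= K because the
    errors are nonnegative. *)
Lemma rms_pairs_le (R : realType) (n : nat) (e : 'I_n -> 'I_n -> \bar R) (K : R) :
  (2 <= n)%N -> (forall i j, 0 <= e i j /\ e i j <= K%:E)%E ->
  (sqrte ((('C(n, 2)%:R)^-1)%:E *
          \sum_(i < n) \sum_(j < n | (i < j)%N) e i j ^+ 2) <= K%:E)%E.
Proof.
move=> n2 eK.
have K0 : 0 <= K.
  have [e0 eK0] := eK (Ordinal (ltnW n2)) (Ordinal (ltnW n2)).
  by rewrite -lee_fin (le_trans e0).
have -> : K%:E = sqrte (K%:E ^+ 2) by rewrite sqrte_sqr gee0_abs.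
rewrite lee_sqrt ?sqre_ge0//.
have C0 : 0 < ('C(n, 2))%:R :> R by rewrite ltr0n bin_gt0.
rewrite lee_pdivrMl//.
have -> : (('C(n, 2))%:R%:E * K%:E ^+ 2 =
    \sum_(i < n) \sum_(j < n | (i < j)%N) K%:E ^+ 2)%E.
  rewrite -EFin_expe -card_ltn_pairs.
  under [RHS]eq_bigr do rewrite sumEFin.
  rewrite sumEFin -EFinM; congr EFin.
  rewrite natr_sum mulr_suml; apply: eq_bigr => i _.
  by rewrite natr_sum mulr_suml; apply: eq_bigr => j _; rewrite mul1r.
apply: lee_sum => i _; apply: lee_sum => j _.
by have [e0 ek] := eK i j; rewrite lee_sqr.
Qed.

Theorem theorem1 (R : realType) (v n : nat) (r eps : R) (x : 'I_n -> 'rV[R]_v)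
  (hv : (1 <= v)%N) (hn : (3 <= n)%N) (hr : 0 < r) (heps : 0 < eps)
  (hx : (density x <= eps%:E)%E) (heps_r : eps <= r / 4) :
  (forall i j : 'I_n,
     (0 <= dist_est r x i j - (eucl_dist (x i) (x j))%:E /\
      dist_est r x i j - (eucl_dist (x i) (x j))%:E
        <= (4 * (eps / r) * eucl_dist (x i) (x j) + r)%:E)%E) /\
  (sqrte ((('C(n, 2)%:R)^-1)%:E *
          \sum_(i < n) \sum_(j < n | (i < j)%N)
             (dist_est r x i j - (eucl_dist (x i) (x j))%:E) ^+ 2)
     <= (4 * (eps / r) * diameter x + r)%:E)%E.
Proof.
have bounds i j : (0 <= dist_est r x i j - (eucl_dist (x i) (x j))%:E /\
    dist_est r x i j - (eucl_dist (x i) (x j))%:E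
      <= (4 * (eps / r) * eucl_dist (x i) (x j) + r)%:E)%E.
  split; first by rewrite sube_ge0 ?dist_est_ge.
  by rewrite leeBlDl// -EFinD dist_est_le// ltW.
split=> //; apply: rms_pairs_le; first exact: ltnW.
move=> i j; have [e0 ek] := bounds i j; split=> //.
apply: le_trans ek _; rewrite lee_fin lerD2r ler_wpM2l ?le_diameter//.
by rewrite mulr_ge0// divr_ge0// ltW.
Qed.
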